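(* Let $n\ge 2$ be an integer, let $\mathrm{PPF}_n$ be the set of prime parking functions of length $n$, and for $\pi\in \mathrm{PPF}_n$ let $\mathrm{fix}(\pi)$ be the number of fixed points of $\pi$. Then, as polynomials in the indeterminate $q$, $$\sum_{\pi\in \mathrm{PPF}_n} q^{\mathrm{fix}(\pi)}=(q+n-2)^{n-1}.$$
   Context: A parking function of length $n$ is a sequence $\pi=(\pi_1,\dots,\pi_n)$ of positive integers such that, if $\lambda_1\le\cdots\le\lambda_n$ is the weakly increasing rearrangement of $\pi_1,\dots,\pi_n$, then $\lambda_i\le i$ for all $1\le i\le n$. A parking function $\pi$ of length $n$ is prime if for all $1\le j\le n-1$ one has $\#\{i: \pi_i\le j\}\ge j+1$. An index $i\in\{1,\dots,n\}$ is a fixed point of $\pi$ if $\pi_i=i$. *)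

(* Defs.v *)
From mathcomp Require Import all_boot all_order all_algebra.

Set Implicit Arguments.
Unset Strict Implicit.
Unset Printing Implicit Defensive.

(* A sequence [s : seq nat] is indexed from 0, so that [pi_i] is
   [nth 0 s i.-1]; the index [i : 'I_n] stands for the position [i.+1]. *)

Definition parking_function (n : nat) (s : seq nat) : bool :=
  [&& size s == n,
      all (fun x => 0 < x) s
    & [forall i : 'I_n, nth 0 (sort leq s) i <= i.+1]].

(* The condition ranges over 1 <= j <= n - 1. *)
Definition prime_parking_function (n : nat) (s : seq nat) : bool :=
  parking_function n s &&
  [forall j : 'I_n, (0 < j) ==> (j.+1 <= count (fun x => x <= j) s)].

Definition fixed_points (n : nat) (s : seq nat) : {set 'I_n} :=
  [set i : 'I_n | nth 0 s i == i.+1].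

Definition fix_count (n : nat) (s : seq nat) : nat := #|fixed_points n s|.

Definition nat_entries (n : nat) (p : n.-tuple 'I_n.+1) : seq nat :=
  [seq val x | x <- p].

(* The entries of a parking function of length n are at most n, so the prime
   parking functions form a finite set of tuples with entries in {0, ..., n};
   [PPF_complete] and [nat_entries_inj] show that [nat_entries] is a bijection
   from it onto all prime parking functions of length n. *)
Definition PPF (n : nat) : {set n.-tuple 'I_n.+1} :=
  [set p | prime_parking_function n (nat_entries p)].

Lemma nat_entries_inj (n : nat) : injective (@nat_entries n).
Proof. by move=> p r /(inj_map val_inj) /val_inj. Qed.

Lemma parking_function_le (n : nat) (s : seq nat) (x : nat) :
  parking_function n s -> x \in s -> x <= n.
Proof.
case/and3P=> /eqP sz _ /forallP le_s; rewrite -(mem_sort leq) => xs.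
have lt_i : index x (sort leq s) < n by rewrite -sz -(size_sort leq) index_mem.
by have := le_s (Ordinal lt_i); rewrite /= nth_index // => /leq_trans; apply.
Qed.

Lemma PPF_complete (n : nat) (s : seq nat) :
  prime_parking_function n s -> exists2 p, p \in PPF n & nat_entries p = s.
Proof.
move=> ppf; have /andP[pf _] := ppf; have /and3P[/eqP sz _ _] := pf.
have szt : size [seq (inord x : 'I_n.+1) | x <- s] == n by rewrite size_map sz.
have E : nat_entries (Tuple szt) = s.
  rewrite /nat_entries /= -map_comp map_id_in // => x xs /=.
  by rewrite inordK // ltnS (parking_function_le pf).
by exists (Tuple szt); rewrite // inE E.
Qed.

(* Main.v *)
(** Read positions 1, ..., n-1 and values modulo m = n-1, keeping position n
    apart. Rotating positions and values of a map simultaneously preserves its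
    fixed points, and by the cycle lemma exactly one of the m rotations of a map
    is prime. Hence m times the left-hand side is the sum of q^fix over all maps
    from the n positions to Z/m, which factors as m * (q + m - 1)^m. *)
Require Import Defs.
From mathcomp Require Import all_boot all_order all_algebra.
From mathcomp Require Import zify.

Import GRing.Theory.
Local Open Scope ring_scope.

(** * Simultaneous rotation of positions and values *)

(* Values are shifted down by one, and [None] is the last position. *)
Notation posmap k := {ffun option 'I_k.+1 -> 'I_k.+1}.

Definition prime_map (k : nat) (f : posmap k) : bool :=
  [forall j : 'I_k.+1, (j.+1 < #|[pred x | (f x <= j)%N]|)%N].

Definition map_fix (k : nat) (f : posmap k) : nat :=
  #|[pred i | f (Some i) == i]|.

Definition rot_map (k : nat) (s : 'I_k.+1) (f : posmap k) : posmap k :=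
  [ffun x => f (omap (+%R^~ s) x) - s].

Definition num_below (k : nat) (f : posmap k) (j : nat) : nat :=
  #|[pred x | (f x < j)%N]|.

Lemma omap_addK (k : nat) (s : 'I_k.+1) :
  cancel (omap (+%R^~ s)) (omap (+%R^~ (- s))).
Proof. by case=> [i|] //=; rewrite addrK. Qed.

Lemma omap_add_bij (k : nat) (s : 'I_k.+1) : bijective (omap (+%R^~ s)).
Proof.
exists (omap (+%R^~ (- s))); first exact: omap_addK.
by move=> x; rewrite -[X in omap (+%R^~ X)]opprK omap_addK.
Qed.

Lemma card_preim_bij (T U : finType) (h : T -> U) (a : pred U) :
  bijective h -> #|[pred x | a (h x)]| = #|a|.
Proof.
move=> bh; rewrite -!sum1_card [RHS](reindex h) //.
exact: onW_bij.
Qed.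

Lemma rot_map_bij (k : nat) (s : 'I_k.+1) : bijective (rot_map k s).
Proof.
apply: injF_bij => f g /ffunP fg; apply/ffunP => y.
have [h _ hK] := omap_add_bij k s.
by have := fg (h y); rewrite !ffunE hK => /addIr.
Qed.

(** The rotated map fixes [i] exactly when [f] fixes [i + s]. *)
Lemma map_fix_rot (k : nat) (s : 'I_k.+1) (f : posmap k) :
  map_fix k (rot_map k s f) = map_fix k f.
Proof.
rewrite /map_fix -[RHS](card_preim_bij _ _ (+%R^~ s)).
  by apply: eq_card => i; rewrite !inE ffunE /= subr_eq.
by exists (+%R^~ (- s)) => i; rewrite ?addrK ?subrK.
Qed.

(** * The cycle lemma *)

Lemma num_below_full (k : nat) (f : posmap k) : num_below k f k.+1 = k.+2.
Proof.
have -> : num_below k f k.+1 = #|{: option 'I_k.+1}|.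
  by apply: eq_card => x; rewrite !inE ltn_ord.
by rewrite card_option card_ord.
Qed.

Lemma num_below0 (k : nat) (f : posmap k) : num_below k f 0 = 0%N.
Proof. by apply: eq_card0 => x; rewrite !inE. Qed.

Lemma ord_subE (k : nat) (v s : 'I_k.+1) :
  nat_of_ord (v - s) = (if s <= v then v - s else v + k.+1 - s)%N.
Proof.
rewrite /= modnDmr; have := ltn_ord v; have := ltn_ord s.
case: (leqP s v) => sv lts ltv.
  have -> : (v + (k.+1 - s) = (v - s) + k.+1)%N by lia.
  by rewrite modnDr modn_small //; lia.
by rewrite modn_small; lia.
Qed.

(** Rotated values below [j] come from values of [f] in the cyclic window of length [j] starting at
    [s]. A wrapping window is the part from [s] up together with an initial segment. *)
Lemma num_below_rot (k : nat) (s : 'I_k.+1) (f : posmap k) (j : nat) :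
    (j <= k.+1)%N ->
  (num_below k (rot_map k s f) j + num_below k f s
    = if s + j <= k.+1 then num_below k f (s + j)
      else k.+2 + num_below k f (s + j - k.+1))%N.
Proof.
move=> lej.
have -> : num_below k (rot_map k s f) j = #|[pred x | ((f x - s)%R < j)%N]|.
  rewrite -[RHS](card_preim_bij _ _ _ _ (omap_add_bij k s)).
  by apply: eq_card => x; rewrite !inE ffunE.
rewrite -(num_below_full k f) /num_below -!sum1_card.
rewrite !(big_mkcond (fun x => x \in _)) -!big_split.
(* The identity already holds for the indicators at each single [x]. *)
case: leqP => sj; rewrite -?big_split; apply: eq_bigr => x _;
  rewrite !inE ord_subE /=;
  move: (ltn_ord (f x)) (ltn_ord s); do !case: ifP; lia.
Qed.

(* The partial sums of the cycle lemma are [num_below f t - t]. *)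
Lemma prime_rotP (k : nat) (s : 'I_k.+1) (f : posmap k) :
  reflect (forall t : nat, (t <= k.+1)%N ->
             if (s < t)%N then (num_below k f s + t < num_below k f t + s)%N
             else (num_below k f s + t <= num_below k f t + s)%N)
          (prime_map k (rot_map k s f)).
Proof.
have full := num_below_full k f; have nb0 := num_below0 k f.
have lts := ltn_ord s.
apply: (iffP forallP) => [pr | good j].
  have {}pr j : (0 < j <= k.+1)%N -> (j < num_below k (rot_map k s f) j)%N.
    case: j => // j /= ltj; exact: pr (Ordinal ltj).
  have pr_gt t : (s < t <= k.+1)%N ->
      (num_below k f s + t < num_below k f t + s)%N.
    move=> /andP[st tk]; have lej : (t - s <= k.+1)%N by lia.
    have := num_below_rot k s f (t - s) lej.
    have : (t - s < num_below k (rot_map k s f) (t - s))%N by apply: pr; lia.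
    rewrite (subnKC (ltnW st)) tk; lia.
  move=> t tk; case: ltnP => st; first by apply: pr_gt; rewrite st.
  (* For [t = 0] the window from [s] ends exactly at [k.+1] without wrapping. The bound follows from
     [t = k.+1], where the partial sum is 1. *)
  case: (posnP t) => [-> | t0].
    have := pr_gt k.+1; rewrite full nb0 leqnn lts => /(_ isT); lia.
  (* For [0 < t < s] the window from [s] to [t] wraps. A full turn raises the partial sum by one, so
     the strict inequality becomes weak. *)
  have [-> // | nst] := eqVneq t s; pose j := (t + k.+1 - s)%N.
  have lej : (j <= k.+1)%N by rewrite /j; lia.
  have := num_below_rot k s f j lej.
  have : (j < num_below k (rot_map k s f) j)%N by apply: pr; rewrite /j; lia.
  have -> : (s + j = t + k.+1)%N by rewrite /j; lia.
  rewrite addnK ifN /j; lia.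
have ltj := ltn_ord j; have := num_below_rot k s f j.+1 ltj.
change #|_| with (num_below k (rot_map k s f) j.+1).
case: (leqP (s + j.+1) k.+1) => sj.
  by have := good _ sj; rewrite ifT; lia.
have lt_k : (s + j.+1 - k.+1 <= k.+1)%N by lia.
by have := good _ lt_k; rewrite ifN; lia.
Qed.

(** By [prime_rotP] a rotation is prime exactly at the last minimum of the partial sums over
    [0, ..., k.+1], and there is only one such place. *)
Lemma unique_prime_rot (k : nat) (f : posmap k) :
  exists s0 : 'I_k.+1,
    forall s : 'I_k.+1, prime_map k (rot_map k s f) = (s == s0).
Proof.
have uniq (s s' : 'I_k.+1) : (s < s')%N ->
    prime_map k (rot_map k s f) -> prime_map k (rot_map k s' f) -> False.
  move=> ss' /prime_rotP /(_ s' (ltnW (ltn_ord s'))); rewrite ss' => h.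
  by move/prime_rotP/(_ s (ltnW (ltn_ord s))); rewrite ltnNge (ltnW ss') /=; lia.
suff [s0 p0] : exists s0 : 'I_k.+1, prime_map k (rot_map k s0 f).
  exists s0 => s; apply/idP/eqP => [ps | -> //]; apply: val_inj.
  by case: (ltngtP s s0) => // lt; [case: (uniq s s0) | case: (uniq s0 s)].
(* The last minimum of the partial sums; the weight breaks ties. *)
pose key (s : 'I_k.+1) :=
  ((num_below k f s + (k.+1 - s)) * k.+2 + (k.+1 - s))%N.
(* The low digit [k.+1 - s] is less than the base [k.+2], so keys compare lexicographically. *)
have key_lt (a b a' b' : nat) : (b < k.+2)%N -> (b' < k.+2)%N ->
    (a * k.+2 + b <= a' * k.+2 + b')%N ->
  (a <= a')%N /\ ((b' < b)%N -> (a < a')%N) by nia.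
have [s _ smin] := @arg_minnP _ ord0 xpredT key isT.
have lts := ltn_ord s.
have {}smin (t : 'I_k.+1) :
  (num_below k f s + (k.+1 - s) <= num_below k f t + (k.+1 - t))%N /\
  ((s < t)%N -> num_below k f s + (k.+1 - s) < num_below k f t + (k.+1 - t))%N.
  have ltk (u : nat) : (k.+1 - u < k.+2)%N by lia.
  have [le_st lt_st] := key_lt _ _ _ _ (ltk s) (ltk t) (smin t isT).
  by split=> // st; apply: lt_st; have := ltn_ord t; lia.
exists s; apply/prime_rotP => t; rewrite leq_eqVlt => /orP[/eqP -> | tk].
  (* The endpoint [k.+1] is not an index, but its partial sum is 1, above the value 0 at index 0. *)
  have [le0 _] := smin ord0; rewrite lts num_below_full.
  by move: le0; rewrite num_below0 /=; lia.
have [/= le_st lt_st] := smin (Ordinal tk).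
by case: ltnP => [/lt_st|]; lia.
Qed.

(** * The generating function of fixed points *)

Lemma prod_option (k : nat) (F : option 'I_k -> {poly int}) :
  \prod_x F x = F None * \prod_i F (Some i).
Proof.
rewrite (bigD1 None) //=; congr (_ * _).
rewrite (reindex_omap Some id) => [|[i|]] //=.
by apply: eq_bigl => i; rewrite eqxx.
Qed.

Lemma sum_map_fix (k : nat) :
  \sum_(f : posmap k) 'X^(map_fix k f)
    = k.+1%:R * ('X + k%:R) ^+ k.+1 :> {poly int}.
Proof.
(* The weight of a map is a product over positions. Position [None] contributes [k.+1] in total, any
   other ['X + k]. *)
pose w (x : option 'I_k.+1) (v : 'I_k.+1) : {poly int} :=
  if Some v == x then 'X else 1.
transitivity (\prod_x \sum_v w x v).
  rewrite bigA_distr_bigA /=; apply: eq_bigr => f _.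
  rewrite prod_option {1}/w /= mul1r -prodr_const big_mkcond /=.
  by apply: eq_bigr => i _; rewrite inE /w (inj_eq Some_inj).
rewrite prod_option; congr (_ * _).
  by rewrite /w /= sumr_const card_ord.
rewrite -[in RHS](card_ord k.+1) -prodr_const; apply: eq_bigr => i _.
rewrite (bigD1 i) //= /w eqxx; congr (_ + _).
rewrite (eq_bigr (fun=> 1)) => [|v /negPf]; last first.
  by rewrite (inj_eq Some_inj) => ->.
by rewrite sumr_const cardC1 card_ord.
Qed.

Lemma sum_prime_map (k : nat) :
  \sum_(f : posmap k | prime_map k f) 'X^(map_fix k f)
    = ('X + k%:R) ^+ k.+1 :> {poly int}.
Proof.
have k_neq0 : k.+1%:R != 0 :> {poly int}.
  by rewrite -polyC_natr polyC_eq0 Num.Theory.pnatr_eq0.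
apply: (mulfI k_neq0); rewrite -sum_map_fix.
(* Pairs [(s, f)] with a prime rotation are summed in two ways: each [f] has one such [s], and for
   each [s] reindexing by the rotation gives the sum over prime maps. *)
transitivity (\sum_(s : 'I_k.+1) \sum_(f | prime_map k (rot_map k s f))
                'X^(map_fix k f) : {poly int}); last first.
  rewrite (exchange_big_dep xpredT) //=; apply: eq_bigr => f _.
  have [s0 s0P] := unique_prime_rot k f.
  by rewrite (eq_bigl (pred1 s0)) ?big_pred1_eq.
rewrite [RHS](eq_bigr (fun=> \sum_(f : posmap k | prime_map k f)
                               'X^(map_fix k f))).
  by rewrite sumr_const card_ord mulr_natl.
move=> s _; rewrite [RHS](reindex (rot_map k s)).
  by apply: eq_bigr => f _; rewrite map_fix_rot.
exact/onW_bij/rot_map_bij.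
Qed.

(** * Transfer to prime parking functions of length [k.+2] *)

Definition map_tuple (k : nat) (f : posmap k) : k.+2.-tuple 'I_k.+3 :=
  [tuple inord (f (unlift ord_max i)).+1 | i < k.+2].

(** This inverts [map_tuple] only on entries in [1, ..., k.+1]; the entries [0] and [k.+2] are both
    sent to 0. *)
Definition tuple_map (k : nat) (p : k.+2.-tuple 'I_k.+3) : posmap k :=
  [ffun x => inord (tnth p (oapp (lift ord_max) ord_max x)).-1].

Lemma val_map_tuple (k : nat) (f : posmap k) (i : 'I_k.+2) :
  nth 0%N (nat_entries (map_tuple k f)) i = (f (unlift ord_max i)).+1.
Proof.
rewrite (nth_map ord0) ?size_tuple // -tnth_nth tnth_mktuple /= inordK //.
by have := ltn_ord (f (unlift ord_max i)); lia.
Qed.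

Lemma map_tupleK (k : nat) : cancel (@map_tuple k) (@tuple_map k).
Proof.
move=> f; apply/ffunP => x; rewrite ffunE tnth_mktuple.
have -> : unlift ord_max (oapp (lift ord_max) ord_max x) = x.
  by case: x => [i|] /=; rewrite ?liftK ?unlift_none.
by rewrite inordK ?inord_val // !ltnS ltnW.
Qed.

Lemma unlift_max_bij (n : nat) : bijective (unlift (@ord_max n)).
Proof.
exists (oapp (lift ord_max) ord_max) => [i|[i|]] /=; first by case: unliftP.
  by rewrite liftK.
by rewrite unlift_none.
Qed.

Lemma fix_count_map_tuple (k : nat) (f : posmap k) :
  fix_count k.+2 (nat_entries (map_tuple k f)) = map_fix k f.
Proof.
rewrite /fix_count -sum1_card -[map_fix _ _]sum1_card big_mkcond big_ord_recr.
(* The last position [k.+2] exceeds every entry, so it is never fixed. *)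
rewrite inE val_map_tuple eqSS (ltn_eqF (ltn_ord _)) [LHS]addn0.
rewrite [RHS]big_mkcond /=; apply: eq_bigr => i _; rewrite !inE val_map_tuple.
have -> : widen_ord (leqnSn k.+1) i = lift ord_max i.
  by apply: val_inj; rewrite /= /bump leqNgt ltn_ord.
by rewrite liftK eqSS lift_max.
Qed.

Lemma count_map_tuple (k : nat) (f : posmap k) (j : nat) :
  count (fun x => (x <= j)%N) (nat_entries (map_tuple k f)) = num_below k f j.
Proof.
rewrite -sum1_count big_map big_tuple sum1_card.
rewrite -[RHS](card_preim_bij _ _ _ _ (unlift_max_bij k.+1)).
apply: eq_card => i; rewrite [RHS]inE [LHS]unfold_in tnth_mktuple /= inordK //.
by have := ltn_ord (f (unlift ord_max i)); lia.
Qed.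

Lemma count_gt_parking (n : nat) (s : seq nat) :
    size s = n.+1 -> all (fun x => 0 < x <= n)%N s ->
    (forall j, (0 < j <= n)%N -> (j < count (fun x => (x <= j)%N) s)%N) ->
  parking_function n.+1 s.
Proof.
move=> sz /allP s_le cnt; apply/and3P; split; first exact/eqP.
  by apply/allP => x /s_le /andP[].
(* The counts reach only [j = n]; the last sorted entry is instead bounded by [n] directly. *)
apply/forallP => i; have [lt_in | le_ni] := ltnP i n; last first.
  have : nth 0%N (sort leq s) i \in s.
    by rewrite -(mem_sort leq) mem_nth // size_sort sz.
  by move=> /s_le; lia.
apply: (@Order.POrderTheory.nth_count_le _ nat) => /=.
  exact: (sort_sorted leq_total).
rewrite (permP (permEl (perm_sort leq s))).
by apply: ltnW; apply: cnt.
Qed.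

Lemma prime_map_tuple (k : nat) (f : posmap k) :
  prime_parking_function k.+2 (nat_entries (map_tuple k f)) = prime_map k f.
Proof.
have primeE : prime_map k f =
    [forall j : 'I_k.+1, (j.+1 < num_below k f j.+1)%N] by [].
rewrite primeE; apply/andP/forallP => [[_ /forallP pr] j | pr].
  have lt_j : (j.+1 < k.+2)%N by rewrite ltnS.
  by have := pr (Ordinal lt_j); rewrite /= count_map_tuple.
have {}pr j : (0 < j <= k.+1)%N -> (j < num_below k f j)%N.
  by case: j => // j ltj; apply: (pr (Ordinal ltj)).
split; last first.
  apply/forallP => j; apply/implyP => j0; rewrite count_map_tuple.
  by apply: pr; rewrite j0 /= -ltnS ltn_ord.
apply: count_gt_parking => [||j /pr]; last by rewrite count_map_tuple.
  by rewrite size_map size_tuple.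
apply/(all_nthP 0%N) => i; rewrite size_map size_tuple => lti.
by rewrite (val_map_tuple k f (Ordinal lti)) ltn_ord.
Qed.

Lemma tuple_mapK (k : nat) (p : k.+2.-tuple 'I_k.+3) :
  p \in PPF k.+2 -> map_tuple k (tuple_map k p) = p.
Proof.
rewrite inE => /andP[/and3P[_ /allP pos _] /forallP pr].
have szp : size (nat_entries p) = k.+2 by rewrite size_map size_tuple.
(* Primality at [j = k.+1] requires all [k.+2] entries to be at most [k.+1]. *)
have le_p : all (fun x => x <= k.+1)%N (nat_entries p).
  by rewrite all_count eqn_leq count_size szp; exact: pr ord_max.
apply: eq_from_tnth => i; rewrite tnth_mktuple ffunE.
have -> : oapp (lift ord_max) ord_max (unlift ord_max i) = i.
  by case: unliftP.
have p_i : val (tnth p i) \in nat_entries p by rewrite map_f ?mem_tnth.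
have := pos _ p_i; have := allP le_p _ p_i => /= le_k gt0.
by apply: val_inj; rewrite /= !inordK; lia.
Qed.

Theorem theorem3p2 (n : nat) (hn : (2 <= n)%N) :
  \sum_(p in PPF n) 'X^(fix_count n (nat_entries p))
    = ('X + n%:R - 2%:R) ^+ (n - 1) :> {poly int}.
Proof.
case: n hn => [|[|k]] // _.
rewrite (reindex_onto (@map_tuple k) (@tuple_map k)) /=; last exact: tuple_mapK.
rewrite subn1 -addrA -natrB // subn2 -sum_prime_map.
apply: eq_big => [f | f _]; last by rewrite fix_count_map_tuple.
by rewrite inE prime_map_tuple map_tupleK eqxx andbT.
Qed.
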